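(* Let $G$ be a group with identity $e$, let $\mathcal{H}$ be a Hilbert space, let $U: G\to \mathcal{B}(\mathcal{H})$, $g\mapsto U_g$, be a unitary projective representation of $G$, and let $|\varphi\rangle\in\mathcal{H}$ be a unit vector. Let $\Gamma(G,\mathcal{H},U,|\varphi\rangle)$ be the associated confusability graph, and write $g\sim g'$ when $g$ and $g'$ are connected in it. Then: (1) the connected component $H:=\{h\in G \mid h\sim e\}$ is a subgroup of $G$; (2) the connected components of $\Gamma(G,\mathcal{H},U,|\varphi\rangle)$ are exactly the left cosets $gH$, $g\in G$, of $H$ in $G$.
   Context: A unitary projective representation of $G$ is a map $g\mapsto U_g$ into unitary operators on $\mathcal{H}$ such that for all $g,h\in G$ there is a unit-modulus scalar $\omega(g,h)$ with $U_gU_h=\omega(g,h)U_{gh}$. Put $|\varphi_g\rangle:=U_g|\varphi\rangle$. The confusability graph $\Gamma(G,\mathcal{H},U,|\varphi\rangle)$ is the graph with vertex set $G$ in which $g,h\in G$ are joined by an edge whenever $\langle\varphi_g|\varphi_h\rangle\neq 0$. Two elements $g,h\in G$ are connected, $g\sim h$, if and only if there is a finite sequence $g_1,\dots,g_N\in G$ with $g_1=g$, $g_N=h$ and $\prod_{i=1}^{N-1}\langle\varphi_{g_i}|\varphi_{g_{i+1}}\rangle\neq 0$. Connected components are identified with their vertex sets, i.e. the equivalence classes of $\sim$. No topology on $G$ is assumed. *)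

(* Defs.v *)
From HB Require Import structures.
From mathcomp Require Import all_boot all_order all_algebra.
From mathcomp Require Import complex.
From mathcomp Require Import all_classical all_reals all_analysis.

Set Implicit Arguments.
Unset Strict Implicit.
Unset Printing Implicit Defensive.

Import Order.TTheory GRing.Theory Num.Theory.
Import numFieldNormedType.Exports.

Local Open Scope classical_set_scope.
Local Open Scope complex_scope.
Local Open Scope ring_scope.

(* A complex Hilbert space: the norm of a complete normed module over R[i] is
   the one induced by an inner product.  Norms take their values in R[i].     *)
HB.mixin Record CompleteNormedModule_isHilbert (R : realType) H
    & CompleteNormedModule R[i] H := {
  inner : {dot H for (@Num.conj R[i])} ;
  sqr_normE : forall x : H, `|x| ^+ 2 = inner x x
}.

#[short(type="hilbertType")]
HB.structure Definition Hilbert (R : realType) :=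
  {H of CompleteNormedModule R[i] H & CompleteNormedModule_isHilbert R H}.

(* The forms of type {dot _ for _} are linear in their first argument; the
   bracket <x|y> is linear in y and conjugate-linear in x.                    *)
Definition braket (R : realType) (H : hilbertType R) (x y : H) : R[i] :=
  (inner : {dot H for _}) y x.

Section Operators.
Variables (R : realType) (H : hilbertType R).

Definition bounded_operator (A : {linear H -> H}) : Prop :=
  exists M : R, forall x : H, `|A x| <= M%:C * `|x|.

Definition adjoint_operators (A B : {linear H -> H}) : Prop :=
  forall x y : H, braket (A x) y = braket x (B y).

Definition unitary_operator (A : {linear H -> H}) : Prop :=
  bounded_operator A /\
  exists B : {linear H -> H},
    [/\ bounded_operator B, adjoint_operators B A, cancel A B & cancel B A].

End Operators.

Section Confusability.
Variables (R : realType) (G : groupType) (H : hilbertType R).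
Variables (U : G -> {linear H -> H}) (phi : H).

Definition unitary_projective_rep : Prop :=
  (forall g, unitary_operator (U g)) /\
  (forall g h, exists w : R[i], `|w| = 1 /\
     forall x : H, U g (U h x) = w *: U (g * h)%g x).

Definition confusability_graph : rel G :=
  fun g h => braket (U g phi) (U h phi) != 0.

(* Only the values s 1, ..., s N of the sequence matter. *)
Definition connected_by_overlaps (g h : G) : Prop :=
  exists (N : nat) (s : nat -> G),
    [/\ (0 < N)%N, s 1%N = g, s N = h &
        \prod_(1 <= i < N) braket (U (s i) phi) (U (s i.+1) phi) != 0].

Definition component_of (g : G) : set G :=
  [set h | connected_by_overlaps h g].

Definition connected_components : set (set G) := range component_of.

Lemma connected_by_overlapsP (g h : G) :
  connected_by_overlaps g h <->
  exists2 p : seq G, path confusability_graph g p & last g p = h.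
Proof.
split=> [[N [s [N0 s1 sN]]]|[p]].
  rewrite prodf_seq_neq0 => /allP/= sP.
  exists [seq s i | i <- iota 2 N.-1].
    apply/(pathP g) => i; rewrite size_map size_iota => iN.
    have -> : nth g (g :: [seq s j | j <- iota 2 N.-1]) i = s i.+1.
      case: i iN => [//|i] iN /=.
      by rewrite (nth_map 0%N) ?size_iota 1?ltnW // nth_iota 1?ltnW.
    rewrite (nth_map 0%N) ?size_iota // nth_iota //.
    by apply: sP; rewrite mem_index_iota /= -ltn_predRL.
  case: N N0 sN {sP} => [//|[|N]] _ sN /=; first by rewrite -s1.
  by rewrite (last_map s (iota 3 N) 2%N) (last_nth 0%N) size_iota
             -/(iota 2 N.+1) nth_iota // add2n sN.
move=> /(pathP g) gp gh; exists (size p).+1, (fun i => nth g (g :: p) i.-1).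
split=> //; first by rewrite -last_nth.
rewrite prodf_seq_neq0; apply/allP => -[|i]; rewrite mem_index_iota //= ltnS => ip.
exact: gp.
Qed.

End Confusability.

Definition left_coset (G : groupType) (g : G) (K : set G) : set G :=
  [set (g * k)%g | k in K].

(* Main.v *)
(* By unitarity and projectivity every left translation of G preserves the
   moduli of the overlaps, hence the edges of the confusability graph, and so
   the connectedness relation ~.  Thus h ~ g iff g^-1 h lies in the component
   of the identity, which yields both claims at once. *)
Require Import Defs.
From HB Require Import structures.
From mathcomp Require Import all_boot all_order all_algebra.
From mathcomp Require Import complex.
From mathcomp Require Import all_classical all_reals all_analysis.
Import Order.TTheory GRing.Theory Num.Theory.
Import numFieldNormedType.Exports.
Local Open Scope classical_set_scope.
Local Open Scope ring_scope.

(** The adjoint [B] of [A] is also its inverse: moving the right-hand [A] across the bracket as [B]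
    cancels the left-hand one. *)
Lemma braket_unitary {R : realType} {H : hilbertType R} {A : {linear H -> H}}
    (x y : H) :
  unitary_operator A -> braket (A x) (A y) = braket x y.
Proof.
move=> [_ [B [_ BA AK _]]].
by rewrite -BA AK.
Qed.

Lemma braketZ (R : realType) (H : hilbertType R) (a b : R[i]) (x y : H) :
  braket (a *: x) (b *: y) = b * (a^* * braket x y).
Proof. by rewrite /braket linearZl_LR linearZr_LR. Qed.

Lemma braket_eq0_sym (R : realType) (H : hilbertType R) (x y : H) :
  (braket x y == 0) = (braket y x == 0).
(* [hermC] carries a sign, which is $(-1)^0$ for a dot product; only the conjugation remains. *)
Proof. by rewrite /braket hermC /= expr0 mul1r conjC_eq0. Qed.

Lemma confusability_graph_sym (R : realType) (G : groupType)
    (H : hilbertType R) (U : G -> {linear H -> H}) (phi : H) :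
  symmetric (confusability_graph U phi).
Proof. by move=> g h; rewrite /confusability_graph braket_eq0_sym. Qed.

Lemma confusability_graph_mull (R : realType) (G : groupType)
    (H : hilbertType R) (U : G -> {linear H -> H}) (phi : H)
    (repU : unitary_projective_rep U) (k g h : G) :
  confusability_graph U phi (k * g)%g (k * h)%g = confusability_graph U phi g h.
Proof.
have [unitU projU] := repU.
have unimodular_neq0 (w : R[i]) : `|w| = 1 -> w != 0.
  by move=> w1; rewrite -normr_eq0 w1 oner_eq0.
have [a [/unimodular_neq0 a0 Ukg]] := projU k g.
have [b [/unimodular_neq0 b0 Ukh]] := projU k h.
(* Fixing the first vector as [U g phi] inserts [U k] only into the right-hand overlap. The two
   overlaps then differ by the factor $\bar a b \neq 0$. *)
rewrite /confusability_graph -(braket_unitary (U g phi) _ (unitU k)).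
by rewrite Ukg Ukh braketZ !mulf_eq0 conjC_eq0 (negPf a0) (negPf b0).
Qed.

Lemma connected_by_overlaps_refl (R : realType) (G : groupType)
    (H : hilbertType R) (U : G -> {linear H -> H}) (phi : H) (g : G) :
  connected_by_overlaps U phi g g.
Proof. by apply/connected_by_overlapsP; exists [::]. Qed.

Lemma connected_by_overlaps_sym (R : realType) (G : groupType)
    (H : hilbertType R) (U : G -> {linear H -> H}) (phi : H) (g h : G) :
  connected_by_overlaps U phi g h -> connected_by_overlaps U phi h g.
Proof.
move=> /connected_by_overlapsP [p gp <-]; apply/connected_by_overlapsP.
(* The walk backwards: [belast] drops the final vertex, which is the new starting point, and keeps
   [g], the new endpoint. *)
exists (rev (belast g p)); last first.
  by case: p {gp} => //= x p; rewrite rev_cons last_rcons.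
rewrite rev_path (eq_path (e' := confusability_graph U phi)) // => x y.
exact: confusability_graph_sym.
Qed.

Lemma connected_by_overlaps_trans (R : realType) (G : groupType)
    (H : hilbertType R) (U : G -> {linear H -> H}) (phi : H) (g h k : G) :
  connected_by_overlaps U phi g h -> connected_by_overlaps U phi h k ->
  connected_by_overlaps U phi g k.
Proof.
move=> /connected_by_overlapsP [p gp <-] /connected_by_overlapsP [q hq <-].
by apply/connected_by_overlapsP; exists (p ++ q); rewrite ?cat_path ?gp ?last_cat.
Qed.

Lemma connected_by_overlaps_mull {R : realType} {G : groupType}
    {H : hilbertType R} {U : G -> {linear H -> H}} {phi : H}
    (repU : unitary_projective_rep U) (k : G) {g h : G} :
  connected_by_overlaps U phi g h ->
  connected_by_overlaps U phi (k * g)%g (k * h)%g.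
Proof.
move=> /connected_by_overlapsP [p gp <-]; apply/connected_by_overlapsP.
exists (map ( *%g k) p); last by rewrite last_map.
by apply: homo_path gp => x y; rewrite confusability_graph_mull.
Qed.

Theorem proposition2p1 (R : realType) (G : groupType) (H : hilbertType R)
    (U : G -> {linear H -> H}) (phi : H)
    (repU : unitary_projective_rep U) (phi_unit : `|phi| = 1) :
  let K : set G := [set h | connected_by_overlaps U phi h 1%g] in
  group_closed [in K] /\
  connected_components U phi = [set left_coset g K | g in [set: G]].
Proof.
move=> K; split.
  (* One-step subgroup test: the identity and closure under $(g,h) \mapsto gh^{-1}$. *)
  split=> [|g h]; rewrite !inE; first exact: connected_by_overlaps_refl.
  move=> Kg Kh; apply: connected_by_overlaps_trans Kg.
  (* Translating $h \sim e$ by $gh^{-1}$ gives $g \sim gh^{-1}$; it remains to chain this with $g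
     \sim e$. *)
  have := connected_by_overlaps_mull repU (g / h)%g Kh.
  by rewrite divgK mulg1 => /connected_by_overlaps_sym.
have componentE g : component_of U phi g = left_coset g K.
  apply/seteqP; split=> [h hg|_ [k Kk <-]].
    exists (g^-1 * h)%g; last by rewrite mulVKg.
    by rewrite /K /= -(mulVg g); exact: connected_by_overlaps_mull.
  (* Writing only the endpoint [g] as [g * 1] turns the goal into the translate by [g] of $k \sim
     e$. *)
  rewrite /component_of /= -[X in connected_by_overlaps _ _ _ X]mulg1.
  exact: connected_by_overlaps_mull.
by rewrite /connected_components; under eq_fun do rewrite componentE.
Qed.
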